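(* Let $(d_n)_{n\ge1}$ be a fixed sequence of integers $d_n\ge2$. The following functions are identity transformations of $[0;1]$: $$f:\ x=\Delta^{D}_{\varepsilon_1\varepsilon_2\ldots\varepsilon_n\ldots}\ \longmapsto\ \Delta^{-(d_n)}_{\varepsilon_1[d_2-1-\varepsilon_2]\ldots\varepsilon_{2n-1}[d_{2n}-1-\varepsilon_{2n}]\ldots},$$ $$g:\ x=\Delta^{-(d_n)}_{\varepsilon_1\varepsilon_2\ldots\varepsilon_n\ldots}\ \longmapsto\ \Delta^{D}_{\varepsilon_1[d_2-1-\varepsilon_2]\ldots\varepsilon_{2n-1}[d_{2n}-1-\varepsilon_{2n}]\ldots}.$$ (In both cases the odd-indexed digits are kept and each even-indexed digit $\varepsilon_{2n}$ is replaced by $d_{2n}-1-\varepsilon_{2n}$.)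
   Context: For digits $\varepsilon_n\in A_{d_n}=\{0,1,\dots,d_n-1\}$, the representation by the positive Cantor series is $$\Delta^{D}_{\varepsilon_1\varepsilon_2\ldots\varepsilon_n\ldots}=\sum_{n=1}^{\infty}\frac{\varepsilon_n}{d_1d_2\cdots d_n},$$ and the nega-$(d_n)$-representation is $$\Delta^{-(d_n)}_{\varepsilon_1\varepsilon_2\ldots\varepsilon_n\ldots}=\sum_{n=1}^{\infty}\frac{(-1)^{n+1}(1+\varepsilon_n)}{d_1d_2\cdots d_n}.$$ Every number of $[0;1]$ has a representation of each kind. Square brackets in a subscript denote a single digit. *)

(* Defs.v *)
From HB Require Import structures.
From mathcomp Require Import all_boot all_order all_algebra.
From mathcomp Require Import all_classical all_reals all_analysis.
Set Implicit Arguments.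
Unset Strict Implicit.
Unset Printing Implicit Defensive.
Import Order.TTheory GRing.Theory Num.Theory.
Import numFieldNormedType.Exports.
Local Open Scope classical_set_scope.
Local Open Scope ring_scope.

(* Sequences [d] and [e] are indexed from 1: their values at 0 are never
   constrained and never contribute to a represented number. *)

Definition digits (d e : nat -> nat) : Prop :=
  forall n, (1 <= n)%N -> (e n < d n)%N.

Definition base_prod (d : nat -> nat) (n : nat) : nat :=
  (\prod_(1 <= i < n.+1) d i)%N.

(* The representations are relations, so that [cantor_repr d e x] says that
   the series converges and that its sum is [x]. *)
Definition cantor_repr (R : realType) (d e : nat -> nat) (x : R) : Prop :=
  digits d e /\
  (\sum_(1 <= n < N.+1) ((e n)%:R / (base_prod d n)%:R : R)) @[N --> \oo] --> x.

Definition nega_repr (R : realType) (d e : nat -> nat) (x : R) : Prop :=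
  digits d e /\
  (\sum_(1 <= n < N.+1)
     ((-1) ^+ n.+1 * (1 + (e n)%:R) / (base_prod d n)%:R : R))
    @[N --> \oo] --> x.

(* The subtraction is not truncated at the indices [n >= 1] of a sequence of
   digits. *)
Definition flip_even (d e : nat -> nat) (n : nat) : nat :=
  if odd n then e n else (d n - 1 - e n)%N.

(* [f] is given on [0, 1] by the rule "the number with [src]-representation [e]
   is sent to the number with [tgt]-representation [phi e]": the numbers having
   a [src]-representation are exactly those of [0, 1], and the image does not
   depend on which representation is used. The values of [f] outside [0, 1] are
   irrelevant. *)
Definition digit_map (R : realType) (src tgt : (nat -> nat) -> R -> Prop)
    (phi : (nat -> nat) -> (nat -> nat)) (f : R -> R) : Prop :=
  (forall x : R, x \in `[0, 1] <-> exists e, src e x) /\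
  (forall e (x : R), src e x -> tgt (phi e) (f x)).

(* Main.v *)
Require Import Defs.
From HB Require Import structures.
From mathcomp Require Import all_boot all_order all_algebra.
From mathcomp Require Import all_classical all_reals all_analysis.
From mathcomp Require Import ring lra zify.
Set Implicit Arguments.
Unset Strict Implicit.
Unset Printing Implicit Defensive.
Import Order.TTheory GRing.Theory Num.Theory.
Import numFieldNormedType.Exports.
Local Open Scope classical_set_scope.
Local Open Scope ring_scope.

(** Write [P_n = d_1 ... d_n]. Replacing an even-indexed digit [e_n] by
    [d_n - 1 - e_n] turns the term [- (1 + e_n) / P_n] of the nega series into
    [e_n / P_n - 1 / P_(n-1)], while an odd-indexed term is
    [e_n / P_n + 1 / P_n]. The corrections telescope in pairs, so the [N]-th
    partial sums of the two series differ by [1 / P_N] for odd [N] and by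
    nothing for even [N] ([nega_sum_flip]). Since [1 / P_N] tends to 0, flipping
    the even digits turns each kind of representation of [x] into a
    representation of the other kind of the same [x] ([cantor_nega_flip],
    [nega_cantor_flip]).

    The numbers having a Cantor representation are exactly those of [0, 1]
    ([cantor_reprE]): the partial sums stay in [0, 1], and conversely a greedy
    choice of digits approximates [x] within [1 / P_N]. By flipping, the same
    holds of nega representations, so both maps are defined on [0, 1]; by
    uniqueness of limits they are the identity there. *)

Section CantorSeries.
Variables (R : realType) (d : nat -> nat).
Hypothesis hd : forall n, (1 <= n)%N -> (2 <= d n)%N.

(** The [N]-th partial sums of the positive Cantor series and of the nega series
    with digits [e]. *)
Definition cantor_sum (e : nat -> nat) (N : nat) : R :=
  \sum_(1 <= n < N.+1) ((e n)%:R / (base_prod d n)%:R).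

Definition nega_sum (e : nat -> nat) (N : nat) : R :=
  \sum_(1 <= n < N.+1) ((-1) ^+ n.+1 * (1 + (e n)%:R) / (base_prod d n)%:R).

Lemma base_prod0 : base_prod d 0 = 1%N.
Proof. by rewrite /base_prod big_geq. Qed.

Lemma base_prodS n : base_prod d n.+1 = (base_prod d n * d n.+1)%N.
Proof. by rewrite /base_prod big_nat_recr. Qed.

Lemma cantor_sum0 e : cantor_sum e 0 = 0.
Proof. by rewrite /cantor_sum big_geq. Qed.

Lemma cantor_sumS e n :
  cantor_sum e n.+1 = cantor_sum e n + (e n.+1)%:R / (base_prod d n.+1)%:R.
Proof. by rewrite /cantor_sum big_nat_recr. Qed.

Lemma nega_sum0 e : nega_sum e 0 = 0.
Proof. by rewrite /nega_sum big_geq. Qed.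

Lemma nega_sumS e n : nega_sum e n.+1 =
  nega_sum e n + (-1) ^+ n.+2 * (1 + (e n.+1)%:R) / (base_prod d n.+1)%:R.
Proof. by rewrite /nega_sum big_nat_recr. Qed.

Lemma base_prod_ge n : (2 ^ n <= base_prod d n)%N.
Proof.
elim: n => [|n IH]; first by rewrite base_prod0.
by rewrite base_prodS expnSr leq_mul // hd.
Qed.

Lemma base_prod_gt0 n : 0 < (base_prod d n)%:R :> R.
Proof. by rewrite ltr0n (leq_trans _ (base_prod_ge n)) ?expn_gt0. Qed.

Lemma base_gt0 n : 0 < (d n.+1)%:R :> R.
Proof. by rewrite ltr0n (leq_trans _ (@hd n.+1 _)). Qed.

Lemma cvg_inv_base_prod : ((base_prod d N)%:R^-1 : R) @[N --> \oo] --> (0 : R).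
Proof.
apply: (@squeeze_cvgr _ _ _ _ (cst 0) (fun N => (2^-1 : R) ^+ N)).
- near=> N; rewrite invr_ge0 ler0n /= exprVn lef_pV2 ?posrE ?base_prod_gt0 //.
  by rewrite -natrX ler_nat base_prod_ge.
- exact: cvg_cst.
- by apply: cvg_expr; rewrite ger0_norm; lra.
Unshelve. all: by end_near. Qed.

(** Since [1 / P_N] tends to 0, sequences that are within [1 / P_N] of each other
    have the same limits. *)
Lemma cvg_close (u v : nat -> R) (x : R) :
  (forall N, `|u N - v N| <= (base_prod d N)%:R^-1) ->
  u N @[N --> \oo] --> x -> v N @[N --> \oo] --> x.
Proof.
move=> uv ux.
have uv0 : (u N - v N) @[N --> \oo] --> (0 : R).
  apply/norm_cvg0P.
  apply: (@squeeze_cvgr _ _ _ _ (cst 0) (fun N => (base_prod d N)%:R^-1)).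
  - by near=> N; rewrite normr_ge0 uv.
  - exact: cvg_cst.
  - exact: cvg_inv_base_prod.
rewrite -[x]subr0 (_ : v = fun N => u N - (u N - v N)); first exact: cvgB.
by apply/funext => N; rewrite opprB addrC subrK.
Unshelve. all: by end_near. Qed.

Lemma digits_flip e : digits d e -> digits d (flip_even d e).
Proof.
move=> he n n1; rewrite /flip_even; case: ifP => _; first exact: he.
by have := hd n1; lia.
Qed.

Lemma flip_evenK e n : digits d e -> (1 <= n)%N ->
  flip_even d (flip_even d e) n = e n.
Proof.
move=> he n1; rewrite /flip_even; case: (odd n) => //.
by have := he n n1; lia.
Qed.

Lemma eq_nega_sum e e' : (forall n, (1 <= n)%N -> e n = e' n) ->
  nega_sum e =1 nega_sum e'.
Proof.
by move=> ee' N; apply: eq_big_nat => n /andP[n1 _]; rewrite ee'.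
Qed.

Lemma nega_sum_flip e N : digits d e ->
  nega_sum (flip_even d e) N =
  cantor_sum e N + (odd N)%:R / (base_prod d N)%:R.
Proof.
move=> he; elim: N => [|N IH].
  by rewrite nega_sum0 cantor_sum0 mul0r addr0.
have P0 := lt0r_neq0 (base_prod_gt0 N); have d0 := lt0r_neq0 (base_gt0 N).
rewrite nega_sumS cantor_sumS IH /flip_even /= base_prodS natrM.
(* For odd [N] the correction [1 / P_N] cancels the [- 1 / P_N] coming from the
   even index [N + 1]; for even [N] the index [N + 1] adds [1 / P_(N+1)]. *)
rewrite -signr_odd /= negbK; case: (odd N) => /=.
  have -> : (d N.+1 - 1 - e N.+1)%:R = (d N.+1)%:R - 1 - (e N.+1)%:R :> R.
    have := he N.+1 isT => lt_ed.
    by rewrite !natrB //; lia.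
  by rewrite expr1; field; rewrite P0 d0.
by rewrite expr0; field; rewrite P0 d0.
Qed.

Lemma nega_cantor_close e N : digits d e ->
  `|nega_sum (flip_even d e) N - cantor_sum e N| <= (base_prod d N)%:R^-1.
Proof.
move=> he; rewrite nega_sum_flip // addrAC subrr add0r.
have P0 := ltW (base_prod_gt0 N).
by case: (odd N); rewrite ?mul1r ?mul0r ?normr0 ?invr_ge0 // ger0_norm ?invr_ge0.
Qed.

Lemma cantor_nega_flip e (x : R) :
  cantor_repr d e x -> nega_repr d (flip_even d e) x.
Proof.
move=> [he ex]; split; first exact: digits_flip.
apply: (@cvg_close (cantor_sum e) (nega_sum (flip_even d e))) ex => N.
by rewrite distrC nega_cantor_close.
Qed.

Lemma nega_cantor_flip e (x : R) :
  nega_repr d e x -> cantor_repr d (flip_even d e) x.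
Proof.
move=> [he ex]; have hfe := digits_flip he; split => //.
apply: (@cvg_close (nega_sum e) (cantor_sum (flip_even d e))) ex => N.
(* Flipping twice may change the value at 0, but no partial sum sees it. *)
rewrite (@eq_nega_sum _ (flip_even d (flip_even d e))) ?nega_cantor_close //.
by move=> n n1; rewrite flip_evenK.
Qed.

Lemma cantor_sum_ge0 e N : 0 <= cantor_sum e N.
Proof. by apply: sumr_ge0 => n _; rewrite divr_ge0. Qed.

(** The maximal digits [d_n - 1] give the partial sum [1 - 1 / P_N]. *)
Lemma cantor_sum_le e N : digits d e ->
  cantor_sum e N <= 1 - (base_prod d N)%:R^-1.
Proof.
move=> he; elim: N => [|N IH]; first by rewrite cantor_sum0 base_prod0 invr1 subrr.
have P0 := base_prod_gt0 N; have d0 := base_gt0 N.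
rewrite cantor_sumS; apply: le_trans (lerD IH (lexx _)) _.
have eS : (e N.+1)%:R + 1 <= (d N.+1)%:R :> R by rewrite natr1 ler_nat he.
rewrite -addrA lerD2l base_prodS natrM -subr_ge0.
have -> : - ((base_prod d N)%:R * (d N.+1)%:R)^-1 -
    (- (base_prod d N)%:R^-1 + (e N.+1)%:R / ((base_prod d N)%:R * (d N.+1)%:R)) =
    ((d N.+1)%:R - ((e N.+1)%:R + 1)) / ((base_prod d N)%:R * (d N.+1)%:R) :> R.
  by field; rewrite !lt0r_neq0.
by rewrite divr_ge0 ?subr_ge0 // mulr_ge0 // ltW.
Qed.

(** The greedy digit of a remainder [r]; the cap at [b - 1] matters only for
    [r = 1], and makes the expansion work for [x = 1] too. *)
Definition greedy_digit (b : nat) (r : R) : nat :=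
  minn (Num.truncn (b%:R * r)) b.-1.

(** The remainder after [n] greedy digits, scaled to [0, 1]:
    [(x - S_n) * P_n], where [S_n] is the [n]-th partial sum. *)
Fixpoint greedy_rem (x : R) (n : nat) : R :=
  if n is m.+1 then
    (d n)%:R * greedy_rem x m - (greedy_digit (d n) (greedy_rem x m))%:R
  else x.

(** The sequence of greedy digits of [x]; its value at 0 is arbitrary. *)
Definition greedy (x : R) (n : nat) : nat :=
  greedy_digit (d n) (greedy_rem x n.-1).

Lemma greedy_digit_bounds (b : nat) (r : R) : (0 < b)%N -> 0 <= r <= 1 ->
  0 <= b%:R * r - (greedy_digit b r)%:R <= 1.
Proof.
move=> b0 /andP[r0 r1].
have br0 : 0 <= b%:R * r by rewrite mulr_ge0.
have /andP[tl tu] := truncn_itv br0.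
rewrite -natr1 in tu.
rewrite /greedy_digit; case: (leqP (Num.truncn (b%:R * r)) b.-1) => tb; first lra.
have : (b.-1)%:R + 1 <= (Num.truncn (b%:R * r))%:R :> R by rewrite natr1 ler_nat.
have : b%:R * r <= b%:R by rewrite ler_piMr.
have : b%:R = (b.-1)%:R + 1 :> R by rewrite natr1 prednK.
lra.
Qed.

Lemma greedy_rem_bounds x n : 0 <= x <= 1 -> 0 <= greedy_rem x n <= 1.
Proof.
move=> x01; elim: n => [//|n IH].
by apply: greedy_digit_bounds IH; apply: leq_trans (@hd n.+1 _).
Qed.

Lemma digits_greedy x : digits d (greedy x).
Proof.
move=> n n1; rewrite /greedy /greedy_digit.
by apply: leq_ltn_trans (geq_minr _ _) _; have := hd n1; lia.
Qed.

Lemma greedy_remE x N :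
  x - cantor_sum (greedy x) N = greedy_rem x N / (base_prod d N)%:R.
Proof.
elim: N => [|N IH]; first by rewrite cantor_sum0 base_prod0 subr0 divr1.
rewrite cantor_sumS opprD addrA IH base_prodS natrM /= /greedy /=.
by field; rewrite !lt0r_neq0 ?base_prod_gt0 ?base_gt0.
Qed.

Lemma cantor_reprE (x : R) : x \in `[0, 1] <-> exists e, cantor_repr d e x.
Proof.
rewrite in_itv /=; split=> [x01|[e [he ex]]].
  exists (greedy x); split; first exact: digits_greedy.
  apply: (@cvg_close (cst x) (cantor_sum (greedy x))) (cvg_cst _) => N /=.
  have /andP[r0 r1] := greedy_rem_bounds N x01.
  have P0 := ltW (base_prod_gt0 N).
  by rewrite greedy_remE ger0_norm ?divr_ge0 // ler_piMl ?invr_ge0.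
apply/andP; split.
  by apply: (cvgr_to_ge ex); near=> N; exact: cantor_sum_ge0.
apply: (cvgr_to_le ex); near=> N; apply: le_trans (cantor_sum_le N he) _.
by rewrite gerBl invr_ge0 ltW ?base_prod_gt0.
Unshelve. all: by end_near. Qed.

Lemma nega_reprE (x : R) : x \in `[0, 1] <-> exists e, nega_repr d e x.
Proof.
rewrite cantor_reprE; split=> -[e ex]; exists (flip_even d e).
  exact: cantor_nega_flip.
exact: nega_cantor_flip.
Qed.

Lemma cantor_repr_inj e (x y : R) :
  cantor_repr d e x -> cantor_repr d e y -> x = y.
Proof. by move=> [_ ex] [_ ey]; apply: cvg_unique ex ey. Qed.

Lemma nega_repr_inj e (x y : R) :
  nega_repr d e x -> nega_repr d e y -> x = y.
Proof. by move=> [_ ex] [_ ey]; apply: cvg_unique ex ey. Qed.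

End CantorSeries.

(** A digit rule that preserves the represented number defines exactly the
    identity of [0, 1]. *)
Lemma digit_map_id (R : realType) (src tgt : (nat -> nat) -> R -> Prop) phi :
  (forall x : R, x \in `[0, 1] <-> exists e, src e x) ->
  (forall e x, src e x -> tgt (phi e) x) ->
  (forall e x y, tgt e x -> tgt e y -> x = y) ->
  forall f, digit_map src tgt phi f <-> {in `[0, 1], f =1 id}.
Proof.
move=> srcE src_tgt tgt_inj f; split=> [[_ fE] x /srcE[e ex]|fid].
  exact: tgt_inj (fE _ _ ex) (src_tgt _ _ ex).
split=> // e x ex; rewrite fid; first exact: src_tgt.
by apply/srcE; exists e.
Qed.

Theorem lemma5 (R : realType) (d : nat -> nat)
    (hd : forall n, (1 <= n)%N -> (2 <= d n)%N) :
  (forall f : R -> R,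
     digit_map (cantor_repr d) (nega_repr d) (flip_even d) f
     <-> {in `[0, 1], f =1 id}) /\
  (forall g : R -> R,
     digit_map (nega_repr d) (cantor_repr d) (flip_even d) g
     <-> {in `[0, 1], g =1 id}).
Proof.
split; apply: digit_map_id.
- exact: cantor_reprE.
- exact: cantor_nega_flip.
- exact: nega_repr_inj.
- exact: nega_reprE.
- exact: nega_cantor_flip.
- exact: cantor_repr_inj.
Qed.
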